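(* Let $k\ge 2$ and $n=2k+1$. Every anchored Dyck word $w$ of length $n$ equals $f(\alpha)$ for some $k$-germ $\alpha$, where $f(\alpha)$ is the binary string associated with the $n$-nest $F(\alpha)$ (both defined in the context).
   Context: A $k$-germ ($k\ge 2$) is a string $\alpha=a_{k-1}a_{k-2}\cdots a_1$ of nonnegative integers with $a_{k-1}\in\{0,1\}$ and $0\le a_{i-1}\le a_i+1$ for $1<i<k$. For $\alpha\neq 0^{k-1}$ let $i(\alpha)$ be the index of the rightmost nonzero entry of $\alpha$, and let the parent $\beta$ of $\alpha$ be the $k$-germ equal to $\alpha$ except that $b_{i(\alpha)}=a_{i(\alpha)}-1$; this makes the $k$-germs the nodes of a tree $\mathcal T_k$ rooted at $0^{k-1}$. The $n$-nest $F(\alpha)$ is a string of length $n=2k+1$ over $\{0,1,\dots,k\}$ defined recursively along $\mathcal T_k$: $F(0^{k-1})=0\,1\,2\cdots(k-1)\,k\,k\,(k-1)\cdots 2\,1$; for $\alpha\ne 0^{k-1}$ with parent $\beta$ and $i=i(\alpha)$, write $F(\beta)=W^i|M|Z^i$ where $W^i$, $Z^i$ are the leftmost and rightmost substrings of length $i$, let $c$ be the leftmost entry of $M$, and split $M=X|Y$ where $Y$ starts at the (leftmost) entry equal to $c+1$ in $M$; then $F(\alpha)=W^i|Y|X|Z^i$ (an ''$i$-nested castling''). In $F(\alpha)$ the entry $0$ appears once (at the start) and each $j\in[1,k]$ appears exactly twice. The binary string $f(\alpha)$ is obtained from $F(\alpha)$ by replacing the first appearance of each integer (including the initial $0$) by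 the bit $0$ and the second appearance of each $j\in[1,k]$ by the bit $1$. A Dyck word of length $2k$ is a binary string with $k$ ones in which every prefix has at least as many $0$'s as $1$'s; an anchored Dyck word of length $2k+1$ is a $0$ followed by a Dyck word of length $2k$. *)

(* Defs.v *)
From mathcomp Require Import all_boot.

Set Implicit Arguments.
Unset Strict Implicit.
Unset Printing Implicit Defensive.

(* A germ a_{k-1} a_{k-2} ... a_1 is the list [:: a_{k-1}; ...; a_1], so a_i is
   the i-th entry counted from the right, starting at 1. *)
Definition entry (alpha : seq nat) (i : nat) : nat :=
  nth 0 alpha (size alpha - i).

Definition germ (k : nat) (alpha : seq nat) : Prop :=
  [/\ size alpha = k.-1,
      entry alpha k.-1 \in [:: 0; 1]
    & forall i, 1 < i < k -> entry alpha i.-1 <= entry alpha i + 1].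

Definition rightmost (alpha : seq nat) : nat :=
  (find (fun a => a != 0) (rev alpha)).+1.

Definition parent (alpha : seq nat) : seq nat :=
  let i := rightmost alpha in
  set_nth 0 alpha (size alpha - i) (entry alpha i - 1).

(* If c + 1 does not occur in M then Y is empty; on the nests below c + 1 always
   occurs. *)
Definition castling (i : nat) (s : seq nat) : seq nat :=
  let W := take i s in
  let M := take (size s - 2 * i) (drop i s) in
  let Z := drop (size s - i) s in
  let c := head 0 M in
  let X := take (index (c + 1) M) M in
  let Y := drop (index (c + 1) M) M in
  W ++ Y ++ X ++ Z.

Definition root_nest (k : nat) : seq nat := iota 0 k.+1 ++ rev (iota 1 k).

(* The depth of alpha in the tree is the sum of its entries, which serves as
   recursion bound; nest_root and nest_castling are the defining equations. *)
Fixpoint nest_rec (k depth : nat) (alpha : seq nat) : seq nat :=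
  if depth is d.+1 then castling (rightmost alpha) (nest_rec k d (parent alpha))
  else root_nest k.

Definition nest (k : nat) (alpha : seq nat) : seq nat :=
  nest_rec k (sumn alpha) alpha.

(* Bits: false is 0, true is 1. *)
Definition appearance_bits (s : seq nat) : bitseq :=
  [seq nth 0 s j \in take j s | j <- iota 0 (size s)].

Definition germ_word (k : nat) (alpha : seq nat) : bitseq :=
  appearance_bits (nest k alpha).

Definition dyck_word (k : nat) (w : bitseq) : Prop :=
  [/\ size w = 2 * k, count_mem true w = k
    & forall m, count_mem true (take m w) <= count_mem false (take m w)].

Definition anchored_dyck_word (k : nat) (w : bitseq) : Prop :=
  exists2 d, dyck_word k d & w = false :: d.

Lemma nest_root k : nest k (nseq k.-1 0) = root_nest k.
Proof. by rewrite /nest sumn_nseq. Qed.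

Lemma rightmost_bounds alpha : has (fun a => a != 0) alpha ->
  0 < rightmost alpha <= size alpha.
Proof. by rewrite /rightmost /= -(size_rev alpha) -has_find has_rev. Qed.

Lemma entry_rev alpha j : 0 < j <= size alpha ->
  entry alpha j = nth 0 (rev alpha) j.-1.
Proof. by case: j => //= j lt_j; rewrite nth_rev. Qed.

Lemma entry_rightmost alpha : has (fun a => a != 0) alpha ->
  0 < entry alpha (rightmost alpha).
Proof.
move=> nz; rewrite entry_rev ?rightmost_bounds // lt0n.
by apply: (@nth_find _ 0 (fun a => a != 0)); rewrite has_rev.
Qed.

Lemma entry_right0 alpha j : has (fun a => a != 0) alpha ->
  0 < j < rightmost alpha -> entry alpha j = 0.
Proof.
move=> nz /andP[j0 ji]; have /andP[_ ile] := rightmost_bounds nz.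
rewrite entry_rev; last by rewrite j0 (leq_trans (ltnW ji) ile).
have: j.-1 < find (fun a => a != 0) (rev alpha) by rewrite -ltnS prednK.
by move/(before_find 0)/negbFE/eqP.
Qed.

Lemma size_parent alpha : has (fun a => a != 0) alpha ->
  size (parent alpha) = size alpha.
Proof.
move=> nz; have /andP[i0 ile] := rightmost_bounds nz.
rewrite /parent size_set_nth; apply/maxn_idPr.
by rewrite ltn_subrL i0 (leq_trans i0 ile).
Qed.

Lemma sumn_parent alpha : has (fun a => a != 0) alpha ->
  sumn alpha = (sumn (parent alpha)).+1.
Proof.
move=> nz; have /andP[i0 ile] := rightmost_bounds nz.
have lt : size alpha - rightmost alpha < size alpha.
  by rewrite ltn_subrL i0 (leq_trans i0 ile).
rewrite /parent set_nthE lt sumn_cat /=.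
rewrite -[in LHS](cat_take_drop (size alpha - rightmost alpha) alpha).
rewrite sumn_cat (drop_nth 0 lt) /= -/(entry alpha (rightmost alpha)).
by rewrite -addnS -addSn subn1 prednK // entry_rightmost.
Qed.

Lemma entry_parent alpha j : has (fun a => a != 0) alpha ->
  0 < j <= size alpha ->
  entry (parent alpha) j = entry alpha j - (j == rightmost alpha).
Proof.
move=> nz /andP[j0 jle]; have /andP[i0 ile] := rightmost_bounds nz.
rewrite /entry size_parent // /parent nth_set_nth /=.
have [->|ne] := eqVneq j (rightmost alpha); first by rewrite eqxx.
case: eqP => [e|_]; last by rewrite subn0.
by case/eqP: ne; rewrite -(subKn jle) e subKn.
Qed.

Lemma germ_parent k alpha : has (fun a => a != 0) alpha ->
  germ k alpha -> germ k (parent alpha).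
Proof.
move=> nz [sz a1 ale]; have /andP[i0 ile] := rightmost_bounds nz.
have k1 : 0 < k.-1 by rewrite -sz (leq_trans i0).
have kE : k = k.-1.+1 by case: (k) k1.
split; first by rewrite size_parent.
  rewrite entry_parent ?sz ?k1 ?leqnn //.
  by move: a1; rewrite !inE => /orP[] /eqP ->; case: (_ == rightmost _).
move=> j /andP[j1 jk]; have jle : j <= k.-1 by rewrite -ltnS -kE.
have j0 : 0 < j.-1 by case: (j) j1 => [|[]].
have jp : j.-1 <= k.-1 by apply: leq_trans (leq_pred _) jle.
rewrite !entry_parent ?sz ?j0 ?(ltnW j1) //.
have [ji|_] := eqVneq j (rightmost alpha).
  by rewrite entry_right0 // j0 -ji ltn_predL (ltnW j1).
rewrite subn0; apply: leq_trans (leq_subr _ _) _.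
by apply: ale; rewrite j1.
Qed.

Lemma nest_castling k alpha : has (fun a => a != 0) alpha ->
  nest k alpha = castling (rightmost alpha) (nest k (parent alpha)).
Proof. by move=> nz; rewrite {1}/nest sumn_parent. Qed.

(* Main.v *)
Require Import Defs.
From mathcomp Require Import all_boot.
From mathcomp Require Import zify.

(* Read the two appearances of each label of a nest as a pair of matching
    brackets. If [a_j = 0] for all [j <= i], then [F(alpha)] is
    [0 1 ... i G i ... 1], where [G] is a plane forest [T_p ... T_1] whose
    [j]-th tree from the right starts with the label [i + j]. Because of this
    numbering of the roots, an [i]-nested castling moves the rightmost tree
    hanging at [i] to the left of everything that hangs at [i - 1]; after [a]
    castlings the contents of [i - 1] are
    [T_a ... T_1 i(T_p ... T_(a+1))], a forest with [a + 1] trees. Thus the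
    germ condition [a_(i-1) <= a_i + 1] allows precisely the numbers of trees
    that can be moved. Conversely, a nonempty forest [A (B)] arises in this
    way from the forest [B A], which has one node less. *)

Set Implicit Arguments.
Unset Strict Implicit.
Unset Printing Implicit Defensive.

(** * Bits of concatenations and brackets *)

Definition disjoint_seq (U V : seq nat) : bool := ~~ has (mem U) V.

(** A bit depends only on the earlier entries with the same label, and no label of [V] occurs in
    [U]. *)
Lemma appearance_bits_cat U V : disjoint_seq U V ->
  appearance_bits (U ++ V) = appearance_bits U ++ appearance_bits V.
Proof.
move=> dUV; rewrite /appearance_bits size_cat iotaD map_cat add0n; congr (_ ++ _).
  apply/eq_in_map => j; rewrite mem_iota add0n => /andP[_ lt_j].
  by rewrite nth_cat lt_j takel_cat // ltnW.
rewrite -[X in iota X]addn0 iotaDl -map_comp; apply/eq_in_map => j.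
rewrite mem_iota add0n => /andP[_ lt_j] /=.
rewrite nth_cat ltnNge leq_addr /= addKn take_cat ltnNge leq_addr /= addKn.
rewrite mem_cat; suff /negbTE-> : nth 0 V j \notin U by [].
by apply: contra dUV => Uj; apply/hasP; exists (nth 0 V j) => //; apply: mem_nth.
Qed.

Lemma appearance_bits_rcons U c :
  appearance_bits (rcons U c) = rcons (appearance_bits U) (c \in U).
Proof.
rewrite /appearance_bits size_rcons -addn1 iotaD map_cat add0n -[RHS]cats1; congr (_ ++ _).
  apply/eq_in_map => j; rewrite mem_iota add0n => /andP[_ lt_j].
  by rewrite nth_rcons lt_j -cats1 takel_cat // ltnW.
by rewrite /= nth_rcons ltnn eqxx -cats1 take_size_cat.
Qed.

Lemma appearance_bits_bracket c U : c \notin U ->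
  appearance_bits (c :: rcons U c) = false :: rcons (appearance_bits U) true.
Proof.
move=> cU; rewrite -rcons_cons appearance_bits_rcons mem_head -cat1s.
rewrite appearance_bits_cat //; apply/hasPn => x Ux.
by rewrite !inE; apply: contraNneq cU => <-.
Qed.

Lemma disjoint_seq_catl U V W :
  disjoint_seq (U ++ V) W = disjoint_seq U W && disjoint_seq V W.
Proof.
rewrite /disjoint_seq -negb_or -has_predU; congr (~~ _).
by apply: eq_has => x; rewrite /= mem_cat.
Qed.

Lemma disjoint_seqC U V : disjoint_seq U V = disjoint_seq V U.
Proof. by rewrite /disjoint_seq has_sym. Qed.

Lemma disjoint_seq_flatten (Us : seq (seq nat)) V :
  all (disjoint_seq V) Us -> disjoint_seq (flatten (rev Us)) V.
Proof.
elim: Us => [|U Us IH] /=; first by rewrite disjoint_seqC.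
case/andP => dU dUs; rewrite rev_cons flatten_rcons disjoint_seq_catl IH //=.
by rewrite disjoint_seqC.
Qed.

Lemma appearance_bits_flatten (Us : seq (seq nat)) : pairwise disjoint_seq Us ->
  appearance_bits (flatten (rev Us)) = flatten (rev (map appearance_bits Us)).
Proof.
elim: Us => //= U Us IH /andP[dU dUs].
rewrite !rev_cons !flatten_rcons appearance_bits_cat ?IH //.
exact: disjoint_seq_flatten.
Qed.

(** * Dyck words as plane forests *)

(* The trees of a forest are listed from right to left, as in the numbering of
   the roots of a nest. *)
Inductive forest : seq bitseq -> Prop :=
| forest_nil : forest [::]
| forest_cons A B : forest A -> forest B ->
    forest ((false :: rcons (flatten (rev B)) true) :: A).

Lemma forest_cat A B : forest A -> forest B -> forest (A ++ B).
Proof. by move=> fA fB; elim: fA => //= A' B' _ IH fB' _; constructor. Qed.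

Definition ballot (w : bitseq) : Prop :=
  forall m, count_mem true (take m w) <= count_mem false (take m w).

Lemma ballot_prefix p q : ballot (p ++ q) -> ballot p.
Proof.
move=> bpq m; case: (leqP m (size p)) => [le_m|/ltnW/take_oversize->].
  by have := bpq m; rewrite takel_cat.
by have := bpq (size p); rewrite take_size_cat.
Qed.

Lemma ballot_count w : ballot w -> count_mem true w <= count_mem false w.
Proof. by move/(_ (size w)); rewrite take_size. Qed.

Lemma count_forest b ws : forest ws ->
  count_mem b (flatten (rev ws)) = count_mem (~~ b) (flatten (rev ws)).
Proof.
move=> fws; elim: fws b => // A B _ IHA _ IHB b.
rewrite rev_cons flatten_rcons !count_cat /= -!cats1 !count_cat /= IHA IHB.
by case: b; rewrite /=; lia.
Qed.

(** Cut [w] just after its last unmatched 0: what follows is balanced. If [w] ends in 1, the last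
    unmatched 0 of the rest is the partner of this 1. The induction is on length because it is
    applied again to what precedes this partner. *)
Lemma ballot_forest w : ballot w -> exists q ws,
  [/\ forest ws, w = q ++ flatten (rev ws)
    & q = [::] \/ exists q', q = rcons q' false].
Proof.
have [n] := ubnP (size w); elim: n w => // n IHn w lt_w bw.
case/lastP: w => [|p b] in lt_w bw *.
  by exists [::], [::]; split; [constructor | | left].
case: b => [|] in lt_w bw *; last first.
  exists (rcons p false), [::]; split; [constructor | by rewrite cats0 |].
  by right; exists p.
rewrite size_rcons ltnS in lt_w.
have bp : ballot p by apply: (@ballot_prefix _ [:: true]); rewrite cats1.
have [q [B [fB pE qE]]] := IHn p lt_w bp.
case: qE => [q0|[q' q'E]].
  (* With no unmatched 0 in [p], the final 1 would exceed the 0's. *)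
  have := ballot_count bw; rewrite pE q0 -cats1 !count_cat /=.
  by rewrite (count_forest true fB) /=; lia.
rewrite q'E cat_rcons in pE.
have lt_q' : size q' < n.
  by move: lt_w; rewrite pE size_cat /=; lia.
have bq' : ballot q' by apply: (@ballot_prefix _ (false :: flatten (rev B))); rewrite -pE.
have [q1 [A [fA q1E hq1]]] := IHn q' lt_q' bq'.
exists q1, ((false :: rcons (flatten (rev B)) true) :: A); split => //.
  by constructor.
by rewrite pE q1E rev_cons flatten_rcons catA rcons_cat.
Qed.

Lemma dyck_forest k w : dyck_word k w ->
  exists2 ws, forest ws & w = flatten (rev ws).
Proof.
case=> sz ct bw; have [q [ws [fws wE qE]]] := ballot_forest bw.
case: qE => [q0|[q' q'E]]; first by exists ws; rewrite // wE q0.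
(* An unmatched 0 would leave more 0's than 1's in [w]. *)
have bq' : ballot q'.
  by apply: (@ballot_prefix _ (false :: flatten (rev ws))); rewrite -cat_rcons -q'E -wE.
have := ballot_count bq'.
have sw : size w = count_mem true w + count_mem false w.
  by rewrite -(count_predC (pred1 true)); congr (_ + _); apply: eq_count; case.
move: sw sz ct; rewrite wE q'E cat_rcons !count_cat /= (count_forest true fws) /=.
by move=> -> *; exfalso; lia.
Qed.

(** * Castlings acting on blocks *)

Lemma rightmost_zeros s a j : rightmost (s ++ a.+1 :: nseq j 0) = j.+1.
Proof.
rewrite /rightmost rev_cat rev_cons rev_nseq cat_rcons find_cat has_nseq andbF /=.
by rewrite size_nseq addn0.
Qed.

Lemma parent_zeros s a j : parent (s ++ a.+1 :: nseq j 0) = s ++ a :: nseq j 0.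
Proof.
rewrite /parent rightmost_zeros /entry size_cat /= size_nseq addnK.
rewrite nth_cat ltnn subnn /= subn1 set_nthE size_cat /= addnS ltnS leq_addr.
by rewrite take_size_cat // -(cat_rcons a.+1) drop_size_cat ?size_rcons.
Qed.

(** As long as [a] is the rightmost nonzero entry, passing to the parent only lowers it, so all
    these castlings have the same index. *)
Lemma nest_iter_castling k s a j :
  nest k (s ++ a :: nseq j 0) = iter a (castling j.+1) (nest k (s ++ nseq j.+1 0)).
Proof.
elim: a => [|a IHa] //=.
rewrite nest_castling; last by rewrite has_cat /= orbT.
by rewrite rightmost_zeros parent_zeros IHa.
Qed.

(** The first clause also forces the blocks to be nonempty, since the default head 0 is not in
    [iota i.+1 _]. *)
Definition nest_blocks (i : nat) (Us : seq (seq nat)) : Prop :=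
  [/\ map (head 0) Us = iota i.+1 (size Us), all (all (fun x => i < x)) Us
    & pairwise disjoint_seq Us].

Lemma castling_cat i W X c Y Z : size W = i -> size Z = i ->
  head 0 (X ++ c.+1 :: Y) = c -> c.+1 \notin X ->
  castling i (W ++ X ++ c.+1 :: Y ++ Z) = W ++ (c.+1 :: Y) ++ X ++ Z.
Proof.
move=> sW sZ hc cX; set M := X ++ c.+1 :: Y.
have -> : W ++ X ++ c.+1 :: Y ++ Z = W ++ M ++ Z by rewrite /M -catA.
rewrite /castling.
have -> : size (W ++ M ++ Z) - 2 * i = size M by rewrite !size_cat sW sZ; lia.
have -> : size (W ++ M ++ Z) - i = size (W ++ M) by rewrite !size_cat sZ; lia.
have -> : take i (W ++ M ++ Z) = W by rewrite take_size_cat.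
have -> : drop i (W ++ M ++ Z) = M ++ Z by rewrite drop_size_cat.
have -> : drop (size (W ++ M)) (W ++ M ++ Z) = Z by rewrite catA drop_size_cat.
rewrite take_size_cat // hc addn1 /M index_cat (negbTE cX) /= eqxx addn0.
by rewrite take_size_cat // drop_size_cat.
Qed.

(** The middle part starts with [i + t], and [i + t + 1] is the root of its last block, found
    nowhere earlier by disjointness. Hence the part [Y] that moves is exactly this block. *)
Lemma castling_blocks i Us t : nest_blocks i Us -> t < size Us ->
  castling i (iota 0 i ++ flatten (rev (take t Us))
     ++ i :: flatten (rev (drop t Us)) ++ rev (iota 1 i)) =
  iota 0 i ++ flatten (rev (take t.+1 Us))
     ++ i :: flatten (rev (drop t.+1 Us)) ++ rev (iota 1 i).
Proof.
case=> hUs gtUs dUs lt_t.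
have head_nth j : j < size Us -> exists Y, nth [::] Us j = (i + j).+1 :: Y.
  move=> lt_j; have := congr1 (fun s => nth 0 s j) hUs.
  rewrite (nth_map [::]) // nth_iota // addSn.
  by case: (nth _ _ _) => //= x Y ->; exists Y.
have [Y UtE] := head_nth t lt_t.
have UsE : Us = take t Us ++ ((i + t).+1 :: Y) :: drop t.+1 Us.
  by rewrite -UtE -drop_nth // cat_take_drop.
set A := take t Us in UsE *; set B := drop t.+1 Us in UsE *.
have dropE : drop t Us = ((i + t).+1 :: Y) :: B by rewrite (drop_nth [::]) // UtE.
rewrite (take_nth [::]) // dropE UtE !rev_rcons rev_cons flatten_rcons /=.
have notin V : disjoint_seq ((i + t).+1 :: Y) V -> (i + t).+1 \notin V.
  move=> dV; apply: contra dV => Vc; apply/hasP.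
  by exists (i + t).+1; rewrite //= mem_head.
have -> : forall Z : seq nat, flatten (rev A) ++ i :: (flatten (rev B) ++ (i + t).+1 :: Y) ++ Z =
   (flatten (rev A) ++ i :: flatten (rev B)) ++ (i + t).+1 :: Y ++ Z.
  by move=> Z; rewrite -!catA /=.
rewrite castling_cat ?size_iota ?size_rev ?size_iota //.
- by rewrite /= -!catA /=.
(* The leftmost entry is [i] itself for [t = 0], and otherwise the root of the last block moved. *)
- rewrite /A; case: (t) lt_t => [|t'] lt_t; first by rewrite take0 /= addn0.
  have [Y' Y'E] := head_nth t' (ltnW lt_t).
  by rewrite (take_nth [::] (ltnW lt_t)) rev_rcons /= Y'E /= addnS.
move: dUs; rewrite UsE pairwise_cat allrel_consr /=.
case/and3P => /andP[dA _] _ /andP[dB _].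
rewrite mem_cat inE !negb_or; apply/and3P; split.
- apply: notin; rewrite disjoint_seqC; apply: disjoint_seq_flatten.
  by apply: sub_all dA => V; rewrite disjoint_seqC.
- by lia.
by apply: notin; rewrite disjoint_seqC; apply: disjoint_seq_flatten.
Qed.

Lemma iter_castling_blocks i Us t : nest_blocks i Us -> t <= size Us ->
  iter t (castling i) (iota 0 i.+1 ++ flatten (rev Us) ++ rev (iota 1 i)) =
  iota 0 i ++ flatten (rev (take t Us))
     ++ i :: flatten (rev (drop t Us)) ++ rev (iota 1 i).
Proof.
move=> bUs; elim: t => [|t IHt] le_t.
  by rewrite take0 drop0 /iter -(addn1 i) iotaD -catA.
by rewrite iterS IHt ?castling_blocks // ltnW.
Qed.

(** The closing [i.+1] is the first entry of the right end [rev (iota 1 i.+1)]. The moved blocks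
    have roots from [i + 2] on, so the new tree with root [i.+1] continues the numbering to the
    right. *)
Lemma nest_blocks_bracket i Us a : nest_blocks i.+1 Us -> a <= size Us ->
  nest_blocks i ((i.+1 :: rcons (flatten (rev (drop a Us))) i.+1) :: take a Us).
Proof.
case=> hUs gtUs dUs le_a; split.
- rewrite /= map_take hUs size_takel // take_iota.
  by rewrite (minn_idPl le_a).
- have gt_i V : all (fun x => i.+1 < x) V -> all (fun x => i < x) V.
    by apply: sub_all => x /ltnW.
  rewrite /= leqnn all_rcons leqnn /=.
  move: gtUs; rewrite -{1}(cat_take_drop a Us) all_cat => /andP[gtA gtB].
  apply/andP; split; last exact: sub_all gtA.
  apply: gt_i; apply/allP => x /flattenP[W]; rewrite mem_rev => BW Wx.
  exact: (allP (allP gtB W BW) x Wx).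
move: dUs gtUs; rewrite -{1 2}(cat_take_drop a Us) pairwise_cat all_cat /=.
case/and3P => dAB dA dB /andP[gtA _]; rewrite dA andbT.
apply/allP => V AV; rewrite -cat1s -cats1 !disjoint_seq_catl.
have -> : disjoint_seq [:: i.+1] V.
  apply/hasPn => x Vx; rewrite !inE.
  by have /allP/(_ x Vx) := allP gtA V AV; rewrite /= => /gtn_eqF->.
rewrite andbT; apply: disjoint_seq_flatten.
by apply/allP => W BW; apply: (allrelP dAB).
Qed.

(** * Building the germ from the forest *)

Lemma iota_rcons m n : iota m n.+1 = rcons (iota m n) (m + n).
Proof. by rewrite -addn1 iotaD cats1. Qed.

(** Induction on the number [m.+1] of nodes, with [i] general because each new entry of the germ
    uses up one trailing zero. The initial 0 of [path] and [last] acts as an entry before the germ: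
    it bounds the first entry by 1 and counts the single tree of the root nest. *)
Lemma nest_forest m ws i : forest ws -> size (flatten ws) = m.+1.*2 ->
  exists s Us,
  [/\ size s = m, path (fun a b => b <= a.+1) 0 s, nest_blocks i Us,
      map appearance_bits Us = ws
    & size Us = (last 0 s).+1 /\
      nest (i + m.+1) (s ++ nseq i 0) =
        iota 0 i.+1 ++ flatten (rev Us) ++ rev (iota 1 i)].
Proof.
elim: m ws i => [|m IHm] ws i [|A B fA fB] //=.
  rewrite size_cat size_rcons => sz.
  have : size (flatten A) = 0 by lia.
  have : size (flatten (rev B)) = 0 by lia.
  case: fB => [|? ? _ _]; last by rewrite rev_cons flatten_rcons size_cat /=; lia.
  case: fA => // _ _.
  exists [::], [:: [:: i.+1; i.+1]]; split => //=.
  - by split=> //=; rewrite leqnn.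
  - by rewrite /appearance_bits /= inE eqxx.
  split=> //; rewrite addn1 -[nseq i 0]/(nseq i.+1.-1 0) nest_root /root_nest.
  by rewrite -[iota 0 i.+2]/(0 :: iota 1 i.+1) iota_rcons rev_rcons add1n cat_cons cat_rcons.
rewrite size_cat size_rcons => sz.
have szAB : size (flatten (A ++ B)) = m.+1.*2.
  have szB : size (flatten (rev B)) = size (flatten B).
    by rewrite !size_flatten /shape map_rev sumn_rev.
  by rewrite flatten_cat size_cat -szB; lia.
have [s [Us [szs ps bUs bitsUs [szUs nestE]]]] := IHm _ i.+1 (forest_cat fA fB) szAB.
(* The next entry is the number of trees of [A]; the tree count in the induction hypothesis turns
   this bound into the germ condition. *)
have le_a : size A <= size Us by rewrite -(size_map appearance_bits) bitsUs size_cat leq_addr.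
exists (rcons s (size A)).
exists ((i.+1 :: rcons (flatten (rev (drop (size A) Us))) i.+1) :: take (size A) Us).
split.
- by rewrite size_rcons szs.
- by rewrite rcons_path ps /= -szUs.
- exact: nest_blocks_bracket.
- have [_ gtUs dUs] := bUs.
  rewrite /= map_take bitsUs take_size_cat // appearance_bits_bracket.
    rewrite appearance_bits_flatten ?map_drop ?bitsUs ?drop_size_cat //.
    by move: dUs; rewrite -{1}(cat_take_drop (size A) Us) pairwise_cat => /and3P[].
  apply/flattenP => -[V]; rewrite mem_rev => /mem_drop UV Vi.
  by have /allP/(_ _ Vi) := allP gtUs V UV; rewrite /= ltnn.
rewrite /= size_takel // last_rcons; split=> //.
rewrite cat_rcons nest_iter_castling -addSnnS nestE iter_castling_blocks //.
rewrite (iota_rcons 1) rev_rcons add1n rev_cons flatten_rcons.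
by rewrite -!catA cat_cons cat_rcons.
Qed.

Lemma path_germ k s : 1 < k -> size s = k.-1 ->
  path (fun a b => b <= a.+1) 0 s -> germ k s.
Proof.
move=> k1 szs /(pathP 0) ps; split=> //.
  have := ps 0; rewrite /entry szs subnn => /(_ ltac:(lia)) /=.
  by case: (nth 0 s 0) => [|[]].
move=> i /andP[i1 ik]; rewrite /entry szs.
have := ps (k - i) ltac:(lia).
have -> : k - i = (k.-1 - i).+1 by lia.
have -> : k.-1 - i.-1 = (k.-1 - i).+1 by lia.
by rewrite addn1.
Qed.

Theorem theorem3 (k : nat) (hk : 2 <= k) (w : bitseq)
    (hw : anchored_dyck_word k w) :
  exists2 alpha : seq nat, germ k alpha & w = germ_word k alpha.
Proof.
have [d dd ->] := hw; have [sz _ _] := dd.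
have [ws fws dE] := dyck_forest dd.
have kE : k.-1.+1 = k by lia.
have szw : size (flatten ws) = k.-1.+1.*2.
  by rewrite kE -mul2n -sz dE !size_flatten /shape map_rev sumn_rev.
(* For [i = 0] no zeros trail, so [s] is the whole germ, and the label 0 in front gives the anchor
   bit. *)
have [s [Us [szs ps [_ gtUs dUs] bitsUs [_ nestE]]]] := nest_forest 0 fws szw.
exists s; first exact: path_germ.
rewrite add0n kE cats0 in nestE.
rewrite /germ_word nestE cats0 appearance_bits_cat; last first.
  apply/hasPn => x /flattenP[V]; rewrite mem_rev => UV Vx.
  by have /allP/(_ _ Vx) := allP gtUs V UV; rewrite /= inE; case: x {Vx}.
by rewrite appearance_bits_flatten // bitsUs dE.
Qed.
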